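(* Let $G$ be a group, and let $A=\{a_1,\ldots,a_r\}$ and $B=\{b_1,\ldots,b_s\}$ be two finite generating sets of $G$. Then there exists an integer constant $C\geqslant 1$ such that, for all integers $n\geqslant 1$: (i) $\frac1C\,\alpha_B\left(\left\lfloor \frac{n}{C}\right\rfloor\right)\leqslant \alpha_A(n)\leqslant C\,\alpha_B(Cn)$; (ii) $\frac1C\,\beta_B\left(\left\lfloor \frac{n}{C}\right\rfloor\right)\leqslant \beta_A(n)\leqslant C\,\beta_B(Cn)$.
   Context: For a group $G$ with finite generating set $A=\{a_1,\dots,a_r\}$ and $g\in G$, $|g|_A$ is the word length of $g$ with respect to $A$, i.e. the least $m$ such that $g$ is a product of $m$ elements of $A\cup A^{-1}$ ($|1|_A=0$). Automorphisms act on the right. For $\varphi\in\mathrm{Aut}(G)$, $\|\varphi\|_A=|a_1\varphi|_A+\cdots+|a_r\varphi|_A$. Let $\Lambda$ be the group of inner automorphisms of $G$ and $\mathrm{Out}(G)=\mathrm{Aut}(G)/\Lambda$ (elements are cosets $\varphi\Lambda$); for $\Phi\in\mathrm{Out}(G)$, $\|\Phi\|_A=\min\{\|\varphi\|_A\mid\varphi\in\Phi\}$. For $n\in\mathbb{N}=\{0,1,2,\dots\}$, $$\alpha_A(n)=\max\{\|\varphi^{-1}\|_A\mid \varphi\in\mathrm{Aut}(G),\ \|\varphi\|_A\leqslant n\},\qquad \beta_A(n)=\max\{\|\Phi^{-1}\|_A\mid \Phi\in\mathrm{Out}(G),\ \|\Phi\|_A\leqslant n\},$$ with the convention $\max\emptyset=0$;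 the same notation is used for $B$. *)

(* Defs.v *)
From HB Require Import structures.
From mathcomp Require Import all_boot all_order finmap.
From mathcomp Require Import boolp classical_sets.

Set Implicit Arguments.
Unset Strict Implicit.
Unset Printing Implicit Defensive.

Local Open Scope classical_set_scope.
Local Open Scope group_scope.

(* The default value [0] makes [natmax set0 = 0], which is the convention used
   for the growth functions below. The other junk values, [natmin set0] and
   [natmax] of an unbounded set, are not met when the alphabet is a finite
   generating set, since balls for the word length are then finite. *)
Definition natmin (S : set nat) : nat := xget 0%N (S `&` lbound S).
Definition natmax (S : set nat) : nat := xget 0%N (S `&` ubound S).

Section Words.
Variable G : groupType.
Implicit Types (A : {fset G}) (g : G).

Definition generates A : Prop :=
  forall H : {pred G}, group_closed H -> {subset A <= H} -> forall g, g \in H.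

Definition is_word A (w : seq G) : bool :=
  all (fun x => (x \in A) || (x^-1 \in A)) w.

Definition word_length A g : nat :=
  natmin [set size w | w in [set w | is_word A w /\ \prod_(x <- w) x = g]].

End Words.

Section AutomorphismGroup.
Variable G : groupType.

Record Aut := MkAut {
  aut_fun :> {multiplicative G -> G};
  aut_bij : bijective aut_fun
}.

HB.instance Definition _ := gen_eqMixin Aut.
HB.instance Definition _ := gen_choiceMixin Aut.

Lemma aut_eqP (f g : Aut) : f =1 g -> f = g.
Proof.
case: f g => [[f [[fM]]] fbij] [[g [[gM]]] gbij] /= fg.
have {}fg : f = g by exact/funext.
subst g; move: gbij; rewrite (Prop_irrelevance gM fM) => gbij.
by rewrite (Prop_irrelevance gbij fbij).
Qed.

Definition aut_one : Aut := @MkAut idfun (inv_bij (fun=> erefl)).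

(* Automorphisms act on the right: in [f * g], [f] is applied first. *)
Definition aut_mul (f g : Aut) : Aut :=
  @MkAut (g \o f) (bij_comp (aut_bij g) (aut_bij f)).

Definition aut_inv_fun (f : Aut) (y : G) : G := xget 1 [set x | f x = y].

Lemma aut_inv_funK (f : Aut) : cancel (aut_inv_fun f) f.
Proof.
move=> y; have [h _ hK] := aut_bij f.
by apply: (xgetPex 1 (P := [set x | f x = y])); exists (h y); exact: hK.
Qed.

Lemma aut_funK (f : Aut) : cancel f (aut_inv_fun f).
Proof. by move=> x; apply: (bij_inj (aut_bij f)); rewrite aut_inv_funK. Qed.

Lemma aut_inv_funM (f : Aut) : {morph aut_inv_fun f : x y / x * y}.
Proof.
by move=> x y; apply: (bij_inj (aut_bij f)); rewrite gmulfM !aut_inv_funK.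
Qed.

HB.instance Definition _ (f : Aut) :=
  isMultiplicative.Build G G (aut_inv_fun f) (@aut_inv_funM f).

Definition aut_inv (f : Aut) : Aut :=
  @MkAut (aut_inv_fun f) (Bijective (@aut_inv_funK f) (@aut_funK f)).

Lemma aut_mulA : associative aut_mul.
Proof. by move=> f g h; exact: aut_eqP. Qed.

Lemma aut_mul1 : left_id aut_one aut_mul.
Proof. by move=> f; exact: aut_eqP. Qed.

Lemma aut_mulr1 : right_id aut_one aut_mul.
Proof. by move=> f; exact: aut_eqP. Qed.

Lemma aut_mulV : left_inverse aut_one aut_inv aut_mul.
Proof. by move=> f; apply: aut_eqP => x /=; exact: aut_inv_funK. Qed.

Lemma aut_mulrV : right_inverse aut_one aut_inv aut_mul.
Proof. by move=> f; apply: aut_eqP => x /=; exact: aut_funK. Qed.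

HB.instance Definition _ := isGroup.Build Aut
  aut_mulA aut_mul1 aut_mulr1 aut_mulV aut_mulrV.

Definition Inn : set Aut := [set f | exists h : G, forall x, f x = x ^ h].

Definition inn_coset (f : Aut) : set Aut := [set f * i | i in Inn].

End AutomorphismGroup.

Section OuterAutomorphismGroup.
Variable G : groupType.
Implicit Types f g i : Aut G.

Lemma Aut1E (x : G) : (1 : Aut G) x = x. Proof. by []. Qed.

Lemma AutME f g (x : G) : (f * g) x = g (f x). Proof. by []. Qed.

Lemma autV f (x : G) : f x^-1 = (f x)^-1.
Proof.
have f1 : f 1 = 1 by apply: (mulgI (f 1)); rewrite -gmulfM !mulg1.
by apply: (mulgI (f x)); rewrite -gmulfM !mulgV.
Qed.

Lemma Inn1 : Inn (1 : Aut G).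
Proof. by exists 1 => x; rewrite conjg1. Qed.

Lemma InnM f g : Inn f -> Inn g -> Inn (f * g).
Proof.
move=> [h hE] [k kE]; exists (h * k) => x.
by rewrite AutME hE kE conjgM.
Qed.

Lemma InnV f : Inn f -> Inn f^-1.
Proof.
move=> [h hE]; exists h^-1 => x.
by apply: (bij_inj (aut_bij f)); rewrite -AutME mulVg Aut1E hE conjgKV.
Qed.

Lemma InnJ f g : Inn f -> Inn (f ^ g).
Proof.
move=> [h hE]; exists (g h) => x.
by rewrite /(f ^ g) !AutME hE /conjg !gmulfM autV -[g (_ x)]AutME mulVg.
Qed.

Lemma inn_cosetP f g : inn_coset f g <-> Inn (f^-1 * g).
Proof.
split=> [[i iI <-]|fgI]; first by rewrite mulKg.
by exists (f^-1 * g) => //; rewrite mulVKg.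
Qed.

Lemma inn_coset_self f : inn_coset f f.
Proof. by apply/inn_cosetP; rewrite mulVg; exact: Inn1. Qed.

Lemma inn_coset1 : inn_coset (1 : Aut G) = @Inn G.
Proof. by apply/seteqP; split=> f; rewrite inn_cosetP invg1 mul1g. Qed.

Lemma inn_cosetM f g :
  [set p * q | p in inn_coset f & q in inn_coset g] = inn_coset (f * g).
Proof.
apply/seteqP; split=> [_ [_ [i iI <-]] [_ [j jI <-]] <-|_ [i iI <-]].
  exists (i ^ g * j); first exact: InnM (InnJ _ iI) jI.
  by rewrite /conjg !mulgA mulgK.
exists f; first exact: inn_coset_self.
by exists (g * i); [exists i|rewrite mulgA].
Qed.

Lemma inn_cosetV f : [set p^-1 | p in inn_coset f] = inn_coset f^-1.
Proof.
apply/seteqP; split=> [_ [_ [i iI <-]] <-|_ [i iI <-]].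
  exists (i^-1 ^ f^-1); first exact/InnJ/InnV.
  by rewrite invgM /conjg invgK mulKg.
exists (f * i^-1 ^ f); last by rewrite /conjg mulVKg invgM invgK.
by exists (i^-1 ^ f) => //; exact/InnJ/InnV.
Qed.

Record Out := MkOut {
  out_set :> set (Aut G);
  out_setP : exists f, out_set = inn_coset f
}.

HB.instance Definition _ := gen_eqMixin Out.
HB.instance Definition _ := gen_choiceMixin Out.

Implicit Types P Q R : Out.

Lemma out_eqP P Q : P = Q :> set (Aut G) -> P = Q.
Proof.
case: P Q => [p pP] [q qP] /= pq; subst q.
by rewrite (Prop_irrelevance pP qP).
Qed.

Definition out_of f : Out := MkOut (ex_intro _ f erefl).

Lemma out_ofP P : exists f, P = out_of f.
Proof. by have [f Pf] := out_setP P; exists f; exact: out_eqP. Qed.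

Lemma out_mul_subproof P Q :
  exists f, [set p * q | p in P & q in Q] = inn_coset f.
Proof.
have [f ->] := out_setP P; have [g ->] := out_setP Q.
by exists (f * g); exact: inn_cosetM.
Qed.

Lemma out_inv_subproof P : exists f, [set p^-1 | p in P] = inn_coset f.
Proof. by have [f ->] := out_setP P; exists f^-1; exact: inn_cosetV. Qed.

Definition out_mul P Q : Out := MkOut (out_mul_subproof P Q).
Definition out_inv P : Out := MkOut (out_inv_subproof P).

Lemma out_of_mul f g : out_mul (out_of f) (out_of g) = out_of (f * g).
Proof. exact/out_eqP/inn_cosetM. Qed.

Lemma out_of_inv f : out_inv (out_of f) = out_of f^-1.
Proof. exact/out_eqP/inn_cosetV. Qed.

Lemma out_mulA : associative out_mul.
Proof.
move=> P Q R; have [f ->] := out_ofP P; have [g ->] := out_ofP Q.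
by have [h ->] := out_ofP R; rewrite !out_of_mul mulgA.
Qed.

Lemma out_mul1 : left_id (out_of 1) out_mul.
Proof. by move=> P; have [f ->] := out_ofP P; rewrite out_of_mul mul1g. Qed.

Lemma out_mulr1 : right_id (out_of 1) out_mul.
Proof. by move=> P; have [f ->] := out_ofP P; rewrite out_of_mul mulg1. Qed.

Lemma out_mulV : left_inverse (out_of 1) out_inv out_mul.
Proof.
by move=> P; have [f ->] := out_ofP P; rewrite out_of_inv out_of_mul mulVg.
Qed.

Lemma out_mulrV : right_inverse (out_of 1) out_inv out_mul.
Proof.
by move=> P; have [f ->] := out_ofP P; rewrite out_of_inv out_of_mul mulgV.
Qed.

HB.instance Definition _ := isGroup.Build Out
  out_mulA out_mul1 out_mulr1 out_mulV out_mulrV.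

End OuterAutomorphismGroup.

Section Growth.
Variable G : groupType.
Implicit Types (A : {fset G}) (f : Aut G) (P : Out G) (n : nat).

Definition aut_norm A f : nat := (\sum_(a <- A) word_length A (f a))%N.

Definition out_norm A P : nat :=
  natmin [set aut_norm A f | f in (P : set (Aut G))].

Definition alpha A n : nat :=
  natmax [set aut_norm A f^-1 | f in [set f | (aut_norm A f <= n)%N]].

Definition beta A n : nat :=
  natmax [set out_norm A P^-1 | P in [set P : Out G | (out_norm A P <= n)%N]].

End Growth.

(* Main.v *)
Require Import Defs.
From mathcomp Require Import all_boot all_order all_algebra finmap.
From mathcomp Require Import boolp classical_sets cardinality.

(** The norms attached to two finite generating sets are bi-Lipschitz
    equivalent, on automorphisms and on outer automorphisms, and a growth
    function built from a norm depends on the norm only up to such constants.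

    Everything rests on one inequality ([word_length_image]): an automorphism
    [f] stretches a word over [A] letter by letter, so that
    [|g f|_B <= (sum over a in A of |a f|_B) * |g|_A]. With [f = 1] it says
    that word lengths over [A] and [B] are proportional. Applied once with
    [f = 1] and once with [f] itself it bounds [aut_norm B f] by
    [lipschitz A B * aut_norm A f] ([aut_norm_lipschitz]), where the constant
    is symmetric in [A] and [B]. The bound passes to the minimum over a coset
    of inner automorphisms ([out_norm_lipschitz]).

    If [N <= C M] and [M <= C N], an element of [N]-norm at most [n] has
    [M]-norm at most [C n], and the [N]-norm of its inverse is at most [C]
    times the [M]-norm of that inverse; this is [growth_lipschitz]. The maxima
    in question exist because balls are finite: there are finitely many words
    of bounded length, and an automorphism is determined by its values on the
    generators. The lower estimates of the theorem are the upper ones with [A]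
    and [B] exchanged, taken at [n %/ C]. *)

Set Implicit Arguments.
Unset Strict Implicit.
Unset Printing Implicit Defensive.

Import Order.TTheory GRing.Theory Num.Theory.

Local Open Scope classical_set_scope.
Local Open Scope group_scope.

(** * Minima and maxima of sets of natural numbers *)

Section NatExtrema.
Implicit Types (S : set nat) (k m : nat).

Lemma natmin_spec S k : S k ->
  S (natmin S) /\ forall m, S m -> (natmin S <= m)%N.
Proof.
move=> Sk; have exS : exists m, `[< S m >] by exists k; exact/asboolP.
have [m /asboolP Sm mmin] := ex_minnP exS.
have : (S `&` lbound S) (natmin S).
  apply: xgetPex; exists m; split=> // j Sj.
  by rewrite leEnat; exact/mmin/asboolP.
by case=> SM lbM; split=> // j Sj; rewrite -leEnat; exact: lbM.
Qed.

Lemma natmax_le S k : (forall m, S m -> (m <= k)%N) -> (natmax S <= k)%N.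
Proof. by move=> ubk; rewrite /natmax; case: xgetP => // m _ [/ubk]. Qed.

Lemma natmax_ge S k : finite_set S -> S k -> (k <= natmax S)%N.
Proof.
move=> /finite_seqP[s Ss] Sk.
have exS : exists m, `[< S m >] by exists k; exact/asboolP.
have bndS m : `[< S m >] -> (m <= \max_(i <- s) i)%N.
  by move/asboolP; rewrite Ss => ms; exact: leq_bigmax_seq.
have [m /asboolP Sm mmax] := ex_maxnP exS bndS.
have : (S `&` ubound S) (natmax S).
  apply: xgetPex; exists m; split=> // j Sj.
  by rewrite leEnat; exact/mmax/asboolP.
by case=> _ ubM; rewrite -leEnat; exact: ubM.
Qed.

End NatExtrema.

(** * Growth functions of norms on a group *)

Section Growth.
Variable T : groupType.
Implicit Types (N M : T -> nat) (n C : nat).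

(** The common shape of [alpha] and [beta], which are the cases where [T] is
    the group of automorphisms or of outer automorphisms. *)
Definition growth N n : nat :=
  natmax [set N x^-1 | x in [set x | (N x <= n)%N]].

Definition finite_balls N := forall n, finite_set [set x | (N x <= n)%N].

Lemma growth_ge N n x : finite_balls N ->
  (N x <= n)%N -> (N x^-1 <= growth N n)%N.
Proof. by move=> finN Nx; apply: natmax_ge; [exact: finite_image | exists x]. Qed.

Lemma growth_monotone N n m : finite_balls N ->
  (n <= m)%N -> (growth N n <= growth N m)%N.
Proof.
move=> finN nm; apply: natmax_le => _ [x /= Nx <-].
by apply: growth_ge => //; exact: leq_trans nm.
Qed.

(** The first comparison of norms is used on the inverse of an element, the
    second on the element itself. *)
Lemma growth_lipschitz N M C n : finite_balls M ->
  (forall x, N x <= C * M x)%N -> (forall x, M x <= C * N x)%N ->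
  (growth N n <= C * growth M (C * n))%N.
Proof.
move=> finM NM MN; apply: natmax_le => _ [x /= Nx <-].
apply: leq_trans (NM _) _; rewrite leq_mul2l growth_ge ?orbT //.
by apply: leq_trans (MN x) _; rewrite leq_mul2l Nx orbT.
Qed.

(** The lower bound comes from [growth_lipschitz] with [N] and [M] exchanged, at
    [n %/ C], since [C * (n %/ C) <= n]. *)
Lemma growth_equivalent N M C n : finite_balls N -> finite_balls M ->
  (0 < C)%N ->
  (forall x, N x <= C * M x)%N -> (forall x, M x <= C * N x)%N ->
  ((C%:Q)^-1 * (growth M (n %/ C))%:Q <= (growth N n)%:Q
   /\ (growth N n)%:Q <= C%:Q * (growth M (C * n))%:Q)%R.
Proof.
move=> finN finM C0 NM MN; split.
  rewrite ler_pdivrMl ?ltr0n // -natrM ler_nat.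
  apply: leq_trans (growth_lipschitz _ finN MN NM) _.
  by rewrite leq_mul2l growth_monotone ?orbT // mulnC leq_divM.
by rewrite -natrM ler_nat; exact: growth_lipschitz.
Qed.

End Growth.

(** * Word length over a finite generating set *)

(** Used twice: for words over the alphabet of a generating set, and for lists
    of values of an automorphism on the generators. *)
Lemma finite_bounded_seqs (T : Type) (S : set T) n : finite_set S ->
  finite_set [set s : seq T | (size s <= n)%N /\ all (fun x => `[< S x >]) s].
Proof.
move=> finS; elim: n => [|n IHn].
  by apply: sub_finite_set (finite_set1 [::]) => -[|x s] [].
apply: sub_finite_set
  (_ : _ `<=` [set [::]] `|` [set x :: s | x in S & s in _]) _; last first.
  rewrite finite_setU; split; first exact: finite_set1.
  exact: finite_image2 finS IHn.
move=> [_|x s [/= sn /andP[/asboolP Sx Ss]]]; first by left.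
by right; exists x => //; exists s.
Qed.

Section WordLength.
Variable G : groupType.
Implicit Types (A B : {fset G}) (g h : G) (f : Aut G) (w : seq G).

Lemma is_word_inv A w : is_word A w -> is_word A (rev [seq x^-1 | x <- w]).
Proof.
rewrite /is_word all_rev all_map; apply: sub_all => x /=.
by rewrite invgK orbC.
Qed.

Lemma prod_word_inv w :
  \prod_(x <- rev [seq x^-1 | x <- w]) x = (\prod_(x <- w) x)^-1.
Proof.
elim: w => [|x w IHw]; first by rewrite !big_nil invg1.
by rewrite map_cons rev_cons -cats1 big_cat big_seq1 IHw big_cons invgM.
Qed.

Lemma generates_word A g : generates A ->
  exists2 w, is_word A w & \prod_(x <- w) x = g.
Proof.
move=> genA.
pose H := [pred x : G | `[< exists2 w, is_word A w & \prod_(y <- w) y = x >]].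
suff /asboolP : g \in H by [].
apply: genA.
  split; first by apply/asboolP; exists [::] => //; rewrite big_nil.
  move=> _ _ /asboolP[u uA <-] /asboolP[v vA <-]; apply/asboolP.
  exists (u ++ rev [seq x^-1 | x <- v]).
    by rewrite /is_word all_cat [all _ u]uA; exact: is_word_inv.
  by rewrite big_cat prod_word_inv.
move=> a aA; apply/asboolP; exists [:: a]; last by rewrite big_seq1.
by rewrite /is_word /= aA.
Qed.

Lemma geodesic_word A g : generates A ->
  exists w, [/\ is_word A w, \prod_(x <- w) x = g & size w = word_length A g].
Proof.
move=> genA; have [w wA wg] := generates_word g genA.
have [] := @natmin_spec
  [set size w | w in [set w | is_word A w /\ \prod_(x <- w) x = g]] (size w).
  by exists w.
by case=> v [vA vg] vsz _; exists v.
Qed.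

Lemma word_length_le A w : is_word A w ->
  (word_length A (\prod_(x <- w) x) <= size w)%N.
Proof.
move=> wA; have [|_ ] := @natmin_spec
  [set size v | v in [set v | is_word A v /\ \prod_(x <- v) x = \prod_(x <- w) x]]
  (size w).
  by exists w.
by apply; exists w.
Qed.

Lemma word_length1 A : word_length A 1 = 0%N.
Proof.
apply/eqP; rewrite -leqn0.
by have := @word_length_le A [::] isT; rewrite big_nil.
Qed.

Lemma word_lengthM A g h : generates A ->
  (word_length A (g * h) <= word_length A g + word_length A h)%N.
Proof.
move=> genA; have [u [uA <- <-]] := geodesic_word g genA.
have [v [vA <- <-]] := geodesic_word h genA.
rewrite -big_cat -size_cat; apply: word_length_le.
by rewrite /is_word all_cat; apply/andP.
Qed.

Lemma word_lengthV A g : generates A ->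
  (word_length A g^-1 <= word_length A g)%N.
Proof.
move=> genA; have [u [uA <- <-]] := geodesic_word g genA.
rewrite -prod_word_inv -(size_map (fun x => x^-1) u) -size_rev.
exact/word_length_le/is_word_inv.
Qed.

Lemma aut1 f : f 1 = 1.
Proof. by apply: (mulgI (f 1)); rewrite -gmulfM !mulg1. Qed.

(** Along a geodesic word for [g], each letter or its inverse lies in [A], so
    its image has length at most the sum of the lengths of all [f a]. *)
Lemma word_length_image A B f g : generates A -> generates B ->
  (word_length B (f g) <= (\sum_(a <- A) word_length B (f a)) * word_length A g)%N.
Proof.
move=> genA genB; have [w [wA <- <-]] := geodesic_word g genA.
have letter a : a \in A ->
    (word_length B (f a) <= \sum_(a <- A) word_length B (f a))%N.
  by move=> aA; rewrite (big_fsetD1 a) //= leq_addr.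
elim: w wA => [_|x w IHw /= /andP[xA wA]].
  by rewrite big_nil aut1 word_length1.
rewrite big_cons gmulfM mulnS; apply: leq_trans (word_lengthM _ _ genB) _.
apply: leq_add (IHw wA); case/orP: xA => [/letter //|/letter].
by apply: leq_trans; have := word_lengthV (f x^-1) genB; rewrite -autV invgK.
Qed.

Lemma finite_word_ball A n : generates A ->
  finite_set [set g | (word_length A g <= n)%N].
Proof.
move=> genA.
have finS : finite_set [set x | (x \in A) || (x^-1 \in A)].
  apply: (@sub_finite_set _ _ ([set` A] `|` [set x^-1 | x in [set` A]])).
    by move=> x /orP[]; [left | right; exists x^-1; rewrite ?invgK].
  by rewrite finite_setU; split; [|apply: finite_image]; exact: finite_fset.
apply: sub_finite_set
  (finite_image (fun w => \prod_(x <- w) x) (finite_bounded_seqs n finS)).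
move=> g /= gn; have [w [wA wg wsz]] := geodesic_word g genA.
exists w => //; split; first by rewrite wsz.
by apply: sub_all wA => x xA; exact/asboolP.
Qed.

(** * Norms of automorphisms *)

Definition lipschitz A B : nat :=
  ((\sum_(a <- A) word_length B a) * (\sum_(b <- B) word_length A b))%N.

Lemma lipschitzC A B : lipschitz A B = lipschitz B A.
Proof. exact: mulnC. Qed.

(** One factor of the constant converts the length of each [f b] from [B] to
    [A]; the other expresses each [b] as a word over [A] before applying [f]. *)
Lemma aut_norm_lipschitz A B f : generates A -> generates B ->
  (aut_norm B f <= lipschitz A B * aut_norm A f)%N.
Proof.
move=> genA genB; rewrite /lipschitz -mulnA.
set K := (\sum_(a <- A) _)%N.
apply: (@leq_trans (\sum_(b <- B) K * word_length A (f b))%N).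
  by apply: leq_sum => b _; exact: (word_length_image 1 (f b) genA genB).
rewrite -big_distrr leq_mul // big_distrl /=.
by apply: leq_sum => b _; rewrite mulnC; exact: word_length_image.
Qed.

Lemma aut_eq_on_generators A f f' : generates A ->
  {in A, f =1 f'} -> f = f'.
Proof.
move=> genA ff'; apply: aut_eqP => g.
have [w wA <-] := generates_word g genA.
elim: w wA => [_|x w IHw /= /andP[xA /IHw fw]].
  by rewrite big_nil !aut1.
rewrite big_cons !gmulfM fw; congr (_ * _).
case/orP: xA => [/ff' //|/ff']; rewrite !autV; exact: invg_inj.
Qed.

(** An automorphism of norm at most [n] is determined by the list of its values
    on [A], all of which lie in the finite ball of radius [n]. *)
Lemma finite_aut_balls A : generates A -> finite_balls (aut_norm A).
Proof.
move=> genA n.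
have finL := finite_bounded_seqs #|` A| (finite_word_ball n genA).
apply: sub_finite_set (finite_preimage (f := fun f => [seq f a | a <- A]) _ finL).
  move=> f /= fn; split; first by rewrite size_map.
  apply/allP => _ /mapP[a aA ->]; apply/asboolP => /=.
  by apply: leq_trans fn; rewrite /aut_norm (big_fsetD1 a) //= leq_addr.
move=> f f' _ _ /eq_in_map ff'; exact: aut_eq_on_generators genA _.
Qed.

(** * Norms of outer automorphisms *)

Implicit Type P : Out G.

Lemma out_norm_attained A P : exists2 f, P = out_of f & aut_norm A f = out_norm A P.
Proof.
have [f0 Pf0] := out_ofP P.
have [|] := @natmin_spec [set aut_norm A f | f in (P : set (Aut G))] (aut_norm A f0).
  by exists f0; rewrite // Pf0; exact: inn_coset_self.
rewrite {1}Pf0 => -[f [i iI fE] fn] _; exists f => //.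
(* [f] and [f0] differ by the inner automorphism [i], so their cosets agree. *)
rewrite Pf0 -fE; apply: out_eqP; apply/seteqP; split=> h /inn_cosetP hI.
  by apply/inn_cosetP; rewrite invgM -mulgA; exact/(InnM _ hI)/InnV.
apply/inn_cosetP; rewrite -[f0^-1](mulVKg i) mulgA.
by rewrite invgM -mulgA in hI; rewrite -!mulgA; exact: InnM iI hI.
Qed.

Lemma out_norm_le A f : (out_norm A (out_of f) <= aut_norm A f)%N.
Proof.
have memf : [set aut_norm A g | g in (out_of f : set (Aut G))] (aut_norm A f).
  by exists f => //; exact: inn_coset_self.
exact: (natmin_spec memf).2.
Qed.

Lemma out_norm_lipschitz A B P : generates A -> generates B ->
  (out_norm B P <= lipschitz A B * out_norm A P)%N.
Proof.
move=> genA genB; have [f -> <-] := out_norm_attained A P.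
exact: leq_trans (out_norm_le B f) (aut_norm_lipschitz f genA genB).
Qed.

Lemma finite_out_balls A : generates A -> finite_balls (out_norm A).
Proof.
move=> genA n.
apply: sub_finite_set (finite_image (@out_of G) (finite_aut_balls genA n)).
move=> P /= Pn; have [f Pf fE] := out_norm_attained A P.
by exists f; [rewrite fE | rewrite Pf].
Qed.

End WordLength.

(** * Comparison of the growth functions *)

Local Close Scope group_scope.
Local Close Scope classical_set_scope.
Local Open Scope ring_scope.

Theorem proposition1p2 (G : groupType) (A B : {fset G})
    (hA : generates A) (hB : generates B) :
  exists2 C : nat, (1 <= C)%N & forall n : nat, (1 <= n)%N ->
    ((C%:Q)^-1 * (alpha B (n %/ C))%:Q <= (alpha A n)%:Q
     /\ (alpha A n)%:Q <= C%:Q * (alpha B (C * n))%:Q) /\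
    ((C%:Q)^-1 * (beta B (n %/ C))%:Q <= (beta A n)%:Q
     /\ (beta A n)%:Q <= C%:Q * (beta B (C * n))%:Q).
Proof.
(* The successor keeps the constant positive when [lipschitz A B] vanishes,
   which happens when [G] is trivial. *)
exists (lipschitz A B).+1 => // n _.
have weaken (k m l : nat) : (k <= l * m -> k <= l.+1 * m)%N.
  by move=> /leq_trans; apply; rewrite leq_mul2r leqnSn orbT.
split; apply: growth_equivalent => //.
- exact: finite_aut_balls.
- exact: finite_aut_balls.
- by move=> f; apply: weaken; rewrite lipschitzC; exact: aut_norm_lipschitz.
- by move=> f; apply: weaken; exact: aut_norm_lipschitz.
- exact: finite_out_balls.
- exact: finite_out_balls.
- by move=> P; apply: weaken; rewrite lipschitzC; exact: out_norm_lipschitz.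
- by move=> P; apply: weaken; exact: out_norm_lipschitz.
Qed.
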